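(* Let $X$ be a charming (Tychonoff) space with a Lindelöf $\Sigma$ kernel $Y$, and put $B=\overline{Y}^{\,X}$ (the closure of $Y$ in $X$). Assume that there exists a closed subset $S$ of $B$ such that $S\subseteq B\setminus Y$, $\operatorname{cov}_K(S)<\mathfrak d$, and every point $x\in (B\setminus Y)\setminus S$ has an open neighborhood $U_x$ in $X$ such that $U_x\cap Y$ is countably compact. Then $X$ is a $D$-space.
   Context: All spaces are Tychonoff (completely regular and Hausdorff); subsets carry the subspace topology. A space $X$ is a $D$-space if for every neighborhood assignment $\varphi$ (a map assigning to each $x\in X$ an open set $\varphi(x)\ni x$) there is a closed discrete set $D\subseteq X$ with $X=\bigcup_{d\in D}\varphi(d)$. A space $Z$ is Lindelöf $\Sigma$ if there are a second countable Tychonoff space $M$ and a map $\Phi$ from $M$ to the nonempty compact subsets of $Z$ that is upper semicontinuous (for each open $U\subseteq Z$, $\{m\in M:\Phi(m)\subseteq U\}$ is open in $M$) with $Z=\bigcup_{m\in M}\Phi(m)$. A space $X$ is charming if it has a Lindelöf $\Sigma$ subspace $Y$ such that for every open $U\subseteq X$ with $Y\subseteq U$, the subspace $X\setminus U$ is Lindelöf $\Sigma$; such a $Y$ is called a Lindelöf $\Sigma$ kernel of $X$. Countably compact means every countable open cover has a finite subcover. For a space $Z$, $\operatorname{cov}_K(Z)$ is the least cardinality of a cover of $Z$ by compact subsets of $Z$. The dominating number $\mathfrak d$ is the least cardinality of a set $\mathcal D\subseteq\omega^\omega$ such that for every $f\in\omega^\omega$ there is $g\in\mathcal D$ with $f(n)\le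 g(n)$ for all but finitely many $n$. *)

(* Defs.v *)
From mathcomp Require Import all_boot all_order all_algebra.
From mathcomp Require Import all_classical all_reals all_analysis.

Set Implicit Arguments.
Unset Strict Implicit.
Unset Printing Implicit Defensive.

Local Open Scope classical_set_scope.
Local Open Scope card_scope.

Definition tychonoff_space (X : topologicalType) : Prop :=
  hausdorff_space X /\ completely_regular_space X.

Definition neighborhood_assignment (X : topologicalType) (phi : X -> set X) :
  Prop := forall x, open (phi x) /\ phi x x.

Definition discrete_subset (X : topologicalType) (D : set X) : Prop :=
  isolated D = D.

Definition D_space (X : topologicalType) : Prop :=
  forall phi : X -> set X, neighborhood_assignment phi ->
    exists D : set X,
      [/\ closed D, discrete_subset D & \bigcup_(d in D) phi d = [set: X]].

Definition upper_semicontinuous (M Z : topologicalType) (Phi : M -> set Z) :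
  Prop := forall U : set Z, open U -> open [set m | Phi m `<=` U].

Definition lindelof_sigma (Z : topologicalType) : Prop :=
  exists (M : topologicalType) (Phi : M -> set Z),
    [/\ tychonoff_space M /\ @second_countable M,
        forall m, Phi m !=set0 /\ compact (Phi m),
        upper_semicontinuous Phi &
        \bigcup_m Phi m = [set: Z]].

(* Here and below, [set_type A] carries the subspace topology of [A]. *)
Definition lindelof_sigma_kernel (X : topologicalType) (Y : set X) : Prop :=
  lindelof_sigma (set_type Y) /\
  forall U : set X, open U -> Y `<=` U -> lindelof_sigma (set_type (~` U)).

Definition charming (X : topologicalType) : Prop :=
  exists Y : set X, lindelof_sigma_kernel Y.

(* Countable covers, finite ones included, are indexed by sets of naturals. *)
Definition countably_compact (Z : topologicalType) : Prop :=
  forall (I : set nat) (U : nat -> set Z), (forall i, I i -> open (U i)) ->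
    [set: Z] `<=` cover I U -> finite_subset_cover I U [set: Z].

Definition compact_cover (Z : topologicalType) (C : set (set Z)) : Prop :=
  (forall K, C K -> compact K) /\ \bigcup_(K in C) K = [set: Z].

Definition dominating (D : set (nat -> nat)) : Prop :=
  forall f : nat -> nat,
    exists2 g, D g & \forall n \near \oo, (f n <= g n)%N.

(* There is no type of cardinals: the cardinal min {|A| : P A} is represented
   by any set A attaining it. *)
Definition least_card (T : Type) (P : set (set T)) (A : set T) : Prop :=
  P A /\ forall B : set T, P B -> A #<= B.

Definition card_lt (T U : Type) (A : set T) (B : set U) : Prop :=
  A #<= B /\ ~ (B #<= A).

(* cov_K(Z) < d; both minima are attained, since cardinals are well-ordered. *)
Definition covK_lt_d (Z : topologicalType) : Prop :=
  exists (C : set (set Z)) (D : set (nat -> nat)),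
    [/\ least_card (@compact_cover Z) C, least_card dominating D &
        card_lt C D].

(* Main.v *)
(* A neighborhood assignment [phi] is first handled on [S], then on what is left
   of [Y], then on the rest of the space.  Being closed in the Lindelof space
   [X] and covered by fewer than [d] compact sets, [S] has Menger's selection
   property, so finite sets of uncovered points can be chosen in [omega] stages
   so that their [phi]-neighborhoods exhaust [S]; each point then has a
   neighborhood meeting only finitely many chosen points.  Outside the open set
   [V] so obtained, [Y] is closed: a point of [closure Y `\` Y] outside [V] has a
   closed neighborhood whose trace on [Y] is Lindelof and countably compact,
   hence compact.  So [Y `\` V] is a closed Lindelof Sigma set, and after it is
   covered the remainder is Lindelof Sigma by the choice of the kernel.  Closed
   Lindelof Sigma sets are treated in [omega] stages as well, stage [k] finishing
   a prescribed member of a countable network modulo compact sets whenever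
   finitely many uncovered points suffice for it. *)

Require Import Defs.
From mathcomp Require Import all_boot all_order all_algebra.
From mathcomp Require Import all_classical all_reals all_analysis.
From mathcomp Require Import Rstruct.

Local Open Scope classical_set_scope.

Definition lindelof_in {X : topologicalType} (A : set X) : Prop :=
  forall (I : Type) (J : set I) (O : I -> set X),
    (forall i, J i -> open (O i)) -> A `<=` cover J O ->
    exists F : nat -> set I,
      (forall n, finite_set (F n) /\ F n `<=` J) /\
      A `<=` \bigcup_n cover (F n) O.

(* [N] is a countable network modulo the family [C] of compact sets. *)
Definition strong_sigma {X : topologicalType} (A : set X) : Prop :=
  exists (C : set (set X)) (N : nat -> set X),
    [/\ C `<=` @compact X, A = \bigcup_(K in C) K &
        forall K U, C K -> open U -> K `<=` U ->
          exists n, K `<=` N n /\ N n `<=` U].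

(** Local finiteness is asked at every point of [X]: unlike discreteness it passes to finite unions,
    and in a T1 space it makes [D] closed and discrete. *)
Definition locally_finite_set {X : topologicalType} (D : set X) : Prop :=
  forall x : X, exists2 W, nbhs x W & finite_set (W `&` D).

Definition D_in {X : topologicalType} (A : set X) : Prop :=
  forall phi : X -> set X, neighborhood_assignment phi ->
    exists D, [/\ D `<=` A, locally_finite_set D & A `<=` cover D phi].

(** * Compactness and countable networks modulo compact sets *)

Lemma finite_set_nat_ub {H : set nat} :
  finite_set H -> exists k, forall h, H h -> (h <= k)%N.
Proof.
move=> /finite_fsetP[S ->]; exists (\max_(h <- finmap.enum_fset S) h)%N => h hS.
exact: leq_bigmax_seq.
Qed.

Lemma compact_finite_subcover {X : topologicalType} {A : set X} {I : Type}
    {J : set I} {O : I -> set X} :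
  compact A -> (forall i, J i -> open (O i)) -> A `<=` cover J O ->
  exists F, [/\ finite_set F, F `<=` J & A `<=` cover F O].
Proof.
move=> /compact_near_coveringP cA oO AJ.
(* [P] is the filter generated by the sets of all [G] containing a given finite subset of [J]; the
   near-covering property along it yields one finite subfamily. *)
pose P := [set Q : set (set I) | exists F, [/\ finite_set F, F `<=` J &
  forall G, F `<=` G -> Q G]].
have FP : Filter P.
  split; first by exists set0; split.
    move=> Q R [F [fF FJ FQ]] [G [fG GJ GR]]; exists (F `|` G); split.
    - by rewrite finite_setU.
    - by move=> x [/FJ|/GJ].
    - move=> H FGH; split; [apply: FQ|apply: GR] => x ?; apply: FGH.
        by left.
      by right.
  by move=> Q R QR [F [? ? FQ]]; exists F; split => // G /FQ /QR.
have [|F [fF FJ FA]] := cA (set I) P (fun G x => cover G O x) FP; last first.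
  by exists F; split => //; apply: FA.
move=> x /AJ[i Ji Oix]; exists (O i, [set G | G i]); first split => /=.
- by apply: open_nbhs_nbhs; split => //; exact: oO.
- by exists [set i]; split => [||G]; [exact: finite_set1|move=> _ ->|apply].
- by move=> [y G] [/= Oy Gi]; exists i.
Qed.

Lemma lindelof_sigma_strong {X : topologicalType} {A : set X} :
  lindelof_sigma (set_type A) -> strong_sigma A.
Proof.
move=> [M [Phi [[_ [B /countable_injP[f finj] [_ bB]]] cPhi uPhi PhiT]]].
have val_cont : continuous (set_val : set_type A -> X).
  by apply/continuousP => U oU; exists U.
exists (range (fun m => set_val @` Phi m)).
(* [f] numbers the countable base; [N n] is the union of the values of [Phi] over the base member
   numbered [n], empty if there is none. *)
exists (fun n => \bigcup_(b in [set b | B b /\ f b = n])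
  \bigcup_(m in b) (set_val @` Phi m)); split.
- move=> _ [m _ <-]; apply: continuous_compact; last by have [] := cPhi m.
  exact: continuous_subspaceT.
- apply/seteqP; split=> [x Ax|x [_ [m _ <-] [y _ <-]]]; last exact: set_valP.
  have : [set: set_type A] (SigSub (mem_set Ax)) by [].
  rewrite -PhiT => -[m _ Phim]; exists (set_val @` Phi m); first by exists m.
  by exists (SigSub (mem_set Ax)).
- move=> _ U [m _ <-] oU PhiU.
  have oV : open [set m' | Phi m' `<=` set_val @^-1` U].
    by apply: uPhi; exists U.
  have [|b [Bb bm] bU] := bB m [set m' | Phi m' `<=` set_val @^-1` U].
    by apply: open_nbhs_nbhs; split => // y Phiy; apply: PhiU; exists y.
  exists (f b); split.
    by move=> x Px; exists b => //; exists m.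
  move=> x [b' [Bb' fbb'] [m' b'm' [y Py <-]]].
  have bb' : b' = b by apply: finj => //; exact: mem_set.
  by rewrite bb' in b'm'; exact: (bU _ b'm').
Qed.

Lemma strong_sigmaI {X : topologicalType} {A F : set X} :
  strong_sigma A -> closed F -> strong_sigma (A `&` F).
Proof.
move=> [C [N [cC -> CN]]] cF.
exists [set K `&` F | K in C], (fun n => N n `&` F); split.
- by move=> _ [K CK <-]; apply: compact_closedI => //; exact: cC.
- apply/seteqP; split=> x.
    by move=> [[K CK Kx] Fx]; exists (K `&` F) => //; exists K.
  by move=> [_ [K CK <-] [Kx Fx]]; split => //; exists K.
- move=> _ U [K CK <-] oU KU.
  (* [U] need not contain [K] off [F], so it is enlarged by the complement of [F]. *)
  have [||n [KN NU]] := CN K (U `|` ~` F) CK.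
  + by apply: openU => //; exact: closed_openC.
  + by move=> x Kx; have [Fx|nFx] := pselect (F x); [left; apply: KU|right].
  + exists n; split=> x [? ?]; first by split => //; exact: KN.
    by have [] := NU x.
Qed.

(** Each [K] lies in a finite union from the cover, and some [N n] fits between them; so it suffices
    to choose a finite subfamily for every [N n] that admits one. *)
Lemma strong_sigma_lindelof {X : topologicalType} {A : set X} :
  strong_sigma A -> lindelof_in A.
Proof.
move=> [C [N [cC -> CN]]] I J O oO AJ.
pose good n (F : set I) := N n `<=` cover F O.
have /choice[F FP] : forall n, exists F, (finite_set F /\ F `<=` J) /\
    ((exists G, [/\ finite_set G, G `<=` J & good n G]) -> good n F).
  move=> n; have [[G [? ? ?]]|nG] :=
    pselect (exists G, [/\ finite_set G, G `<=` J & good n G]).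
    by exists G.
  by exists set0; split=> [|/nG//]; split; [exact: finite_set0|exact: sub0set].
exists F; split=> [n|x [K CK Kx]]; first by case: (FP n).
have KJ : K `<=` cover J O by move=> y Ky; apply: AJ; exists K.
have [G [fG GJ KG]] := compact_finite_subcover (cC _ CK) oO KJ.
have [||n [KN NG]] := CN K (cover G O) CK => //.
  by apply: bigcup_open => i /GJ; exact: oO.
exists n => //; apply: (FP n).2; last exact: KN.
by exists G.
Qed.

(** * Locally finite sets *)

Lemma locally_finite_closed {X : topologicalType} {D : set X} :
  accessible_space X -> locally_finite_set D -> closed D.
Proof.
move=> T1 lfD x clx; have [W Wx fW] := lfD x.
apply: contrapT => nDx.
have /closed_openC oC := accessible_finite_set_closed.1 T1 _ fW.
have [|y [Dy [Wy]]] := clx (W `&` ~` (W `&` D)); last by apply.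
by apply: filterI => //; apply: open_nbhs_nbhs; split => // -[].
Qed.

Lemma locally_finite_discrete {X : topologicalType} {D : set X} :
  accessible_space X -> locally_finite_set D -> discrete_subset D.
Proof.
move=> T1 lfD; apply/seteqP; split=> [x [/set_mem]//|x Dx]; split.
  exact: mem_set.
have [W Wx fW] := lfD x.
have fWx : finite_set ((W `&` D) `\ x) by exact: finite_setD.
have /closed_openC oC := accessible_finite_set_closed.1 T1 _ fWx.
exists (W `&` ~` ((W `&` D) `\ x)).
  by apply: filterI => //; apply: open_nbhs_nbhs; split => // -[_]; apply.
apply/seteqP; split=> [y [[Wy nWy] Dy]|_ ->] /=.
  by apply: contrapT => yx; exact: nWy.
by split => //; split; [exact: nbhs_singleton|move=> [_]; apply].
Qed.

Lemma locally_finite_setU {X : topologicalType} {D E : set X} :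
  locally_finite_set D -> locally_finite_set E -> locally_finite_set (D `|` E).
Proof.
move=> lD lE x; have [V Vx fV] := lD x; have [W Wx fW] := lE x.
exists (V `&` W); first exact: filterI.
have fVW : finite_set ((V `&` D) `|` (W `&` E)) by rewrite finite_setU.
by apply: sub_finite_set fVW => y [[? ?] [?|?]]; [left|right].
Qed.

Lemma open_cover {X : topologicalType} {phi : X -> set X} :
  neighborhood_assignment phi -> forall B, open (cover B phi).
Proof.
by move=> phiP B; apply: bigcup_open => y _; have [] := phiP y.
Qed.

(** A point of [A] lies in some open [cover (E n) phi], which no point added after stage [n] enters;
    this neighborhood meets the union only inside the finite [E n]. *)
Lemma increasing_locally_finite {X : topologicalType} {A : set X}
    {phi : X -> set X} {E : nat -> set X} :
  neighborhood_assignment phi -> closed A ->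
  (forall n, finite_set (E n)) -> (forall n, E n `<=` A) ->
  (forall n, E n `<=` E n.+1) ->
  (forall n x, E n.+1 x -> cover (E n) phi x -> E n x) ->
  A `<=` \bigcup_n cover (E n) phi ->
  locally_finite_set (\bigcup_n E n).
Proof.
move=> phiP cA fE EA Eincr Enew AE x.
have Emono m n : (m <= n)%N -> E m `<=` E n.
  by move=> /subnK <-; elim: (n - m)%N => // k IH y /IH; exact: Eincr.
have [Ax|nAx] := pselect (A x); last first.
  exists (~` A).
    by apply: open_nbhs_nbhs; split => //; exact: closed_openC.
  apply: (sub_finite_set _ (finite_set0 X)) => y [nAy [n _ Eny]].
  exact/nAy/(EA n).
have [n _ Ex] := AE x Ax; exists (cover (E n) phi).
  by apply: open_nbhs_nbhs; split => //; exact: open_cover.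
apply: sub_finite_set (fE n) => y [Vy [m _ Emy]].
have [/Emono|] := leqP m n; first exact.
move=> /ltnW/subnK mn; rewrite -mn in Emy.
elim: (m - n)%N Emy => // k IH Ey; apply: IH; apply: Enew Ey _.
by case: Vy => z Enz phiz; exists z => //; apply: Emono Enz; exact: leq_addl.
Qed.

(** * Closed Lindelof Sigma sets *)

Lemma strong_sigma_D {X : topologicalType} {A : set X} :
  closed A -> strong_sigma A -> D_in A.
Proof.
move=> cA [C [N [cC AE CN]]] phi phiP.
have ophi := open_cover phiP.
pose good n (E G : set X) := [/\ finite_set G, G `<=` A `\` cover E phi &
  N n `<=` cover (E `|` G) phi].
have /choice[G GP] : forall p : nat * set X, exists G,
    (finite_set G /\ G `<=` A `\` cover p.2 phi) /\
    ((exists G', good p.1 p.2 G') -> good p.1 p.2 G).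
  move=> [n E] /=; have [[G' gG]|nG] := pselect (exists G', good n E G').
    by exists G'; split => //; case: gG.
  by exists set0; split=> [|/nG//]; split; [exact: finite_set0|exact: sub0set].
(* [logn 2] takes every value infinitely often. *)
pose E := fix E n := if n is k.+1 then E k `|` G (logn 2 k, E k) else set0.
have fE n : finite_set (E n).
  elim: n => //= n IH; rewrite finite_setU; split => //.
  by case: (GP (logn 2 n, E n)) => -[].
have EA n : E n `<=` A.
  elim: n => // n IH x [/IH//|].
  by case: (GP (logn 2 n, E n)) => -[_ GA] _ /GA[].
have Eincr n : E n `<=` E n.+1 by left.
have Emono m n : (m <= n)%N -> E m `<=` E n.
  by move=> /subnK <-; elim: (n - m)%N => // k IH y /IH; exact: Eincr.
have AcE : A `<=` \bigcup_n cover (E n) phi.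
  move=> x; rewrite {1}AE => -[K CK Kx]; apply: contrapT => nVx.
  pose V := \bigcup_n cover (E n) phi.
  have oV : open V by apply: bigcup_open => n _.
  have KV : compact (K `&` ~` V).
    by apply: compact_closedI; [exact: cC|exact: open_closedC].
  (* The part of [K] missed by all stages is compact, so finitely many of its points, [F], suffice
     for it; being never covered, they stay eligible at every stage. *)
  have [|y Ky|F [fF FK KF]] :=
    @compact_finite_subcover _ _ _ (K `&` ~` V) phi KV.
  - by move=> y _; have [] := phiP y.
  - by exists y => //; have [] := phiP y.
  have [||H [fH _ KH]] := @compact_finite_subcover _ K _ [set: nat]
    (fun n => cover (E n `|` F) phi) (cC _ CK).
  - by move=> n _; exact: ophi.
  - move=> y Ky; have [[n _ [z Ez zy]]|nVy] := pselect (V y).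
      by exists n => //; exists z => //; left.
    by have [//|z Fz zy] := KF y; exists 0%N => //; exists z => //; right.
  have [k Hk] := finite_set_nat_ub fH.
  have KEF : K `<=` cover (E k `|` F) phi.
    move=> y /KH[h Hh [z [Ez|Fz] zy]]; exists z => //; last by right.
    by left; apply: Emono Ez; exact: Hk.
  have [n [KN NEF]] := CN K _ CK (ophi _) KEF.
  (* A stage [j >= k] whose prescribed network member is [N n]: the odd factor leaves the 2-adic
     valuation at [n] and pushes [j] past [k]. *)
  pose j := (2 ^ n * (2 * k).+1)%N.
  have jn : logn 2 j = n.
    rewrite lognM ?expn_gt0// pfactorK// logn_coprime ?addn0//.
    by rewrite coprime2n /= mul2n odd_double.
  have kj : (k <= j)%N.
    rewrite (leq_trans _ (leq_pmull _ _)) ?expn_gt0//.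
    by rewrite mul2n -addnn -addnS leq_addr.
  have [_ []] := GP (logn 2 j, E j).
    exists F; rewrite /= jn; split => //.
      move=> y Fy; have [Ky nVy] := FK _ Fy.
      split; first by rewrite AE; exists K.
      by move=> Ey; apply: nVy; exists j.
    move=> y /NEF[z [Ez|Fz] zy]; exists z => //; last by right.
    by left; apply: Emono Ez.
  move=> _ _; rewrite /= jn => NE; apply: nVx; exists j.+1 => //=.
  by rewrite jn; apply/NE/KN.
exists (\bigcup_n E n); split.
- by move=> x [n _]; exact: EA.
- apply: (increasing_locally_finite phiP cA fE EA Eincr _ AcE).
  move=> n x [//|]; case: (GP (logn 2 n, E n)) => -[_ GA] _ /GA[_ nE] cE.
  by case: (nE cE).
- by move=> x /AcE[n _ [z Ez zx]]; exists z => //; exists n.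
Qed.

(** * Selections against fewer than [d] compact sets *)

Fixpoint play {S : Type} (step : S -> nat -> S) (s0 : S) (f : nat -> nat)
    (k : nat) : S :=
  if k is k'.+1 then step (play step s0 f k') (f k') else s0.

(** The demands [h] depend on the earlier moves, but bounded moves reach only finitely many
    positions at each stage, so the maximal demand of [K] there is a function [g K] fixed in
    advance. An [f] dominated by no [g K] must meet some demand of each [K], as otherwise it would
    stay below [g K]. *)
Lemma undominated_play {T : Type} {S : eqType} {C : set T}
    (h : T -> S -> nat) (step : S -> nat -> S) (s0 : S) :
  (forall g : T -> nat -> nat, ~ dominating (g @` C)) ->
  exists f, forall K, C K ->
    exists k, (h K (play step s0 f k) <= f k)%N.
Proof.
move=> ndom.
(* [Q K k]: the positions reachable in [k] moves against a player whose [i]-th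
   move stays below the largest demand [g K i] of [K] on [Q K i]. *)
pose Q K := fix Q k := if k is k'.+1 then
  [seq step s n | s <- Q k', n <- iota 0 (\max_(s <- Q k') h K s).+1]
  else [:: s0].
pose g K k := \max_(s <- Q K k) h K s.
have := ndom g; rewrite /dominating -existsNE => -[f fP].
exists f => K CK; apply: contrapT => nk.
have fK k : (f k < h K (play step s0 f k))%N.
  by rewrite ltnNge; apply/negP => hf; apply: nk; exists k.
have inQ k : play step s0 f k \in Q K k /\ (f k < g K k)%N.
  have fg j : play step s0 f j \in Q K j -> (f j < g K j)%N.
    by move=> pj; apply: leq_trans (fK j) _; exact: leq_bigmax_seq.
  elim: k => [|k [pk fk]].
    by split; [|apply: fg]; rewrite /= mem_head.
  suff pk1 : play step s0 f k.+1 \in Q K k.+1 by split => //; exact: fg.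
  apply/allpairsP; exists (play step s0 f k, f k); split; [exact: pk| |by []].
  by rewrite mem_iota leq0n add0n ltnS ltnW.
apply: fP; exists (g K); first by exists K.
by apply: nearW => k; case: (inQ k) => _ /ltnW.
Qed.

Lemma compact_cover_lt_d_D {X : topologicalType} {A : set X}
    {C : set (set X)} :
  closed A -> (forall F, closed F -> lindelof_in (A `&` F)) ->
  (forall K, C K -> compact K) -> A = \bigcup_(K in C) K ->
  (forall g : set X -> nat -> nat, ~ dominating (g @` C)) ->
  D_in A.
Proof.
move=> cA lA cC AC ndom phi phiP.
have ophi := open_cover phiP.
have /choice[G GP] : forall E : set X, exists G : nat -> set X,
    [/\ forall n, finite_set (G n) /\ G n `<=` A `\` cover E phi,
        forall m n, (m <= n)%N -> G m `<=` G n &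
        A `<=` \bigcup_n cover (E `|` G n) phi].
  move=> E.
  have [|y Ay|F [FP AF]] := lA _ (open_closedC (ophi E)) X
      (A `\` cover E phi) phi.
  - by move=> y _; have [] := phiP y.
  - by exists y => //; have [] := phiP y.
  (* Partial unions make the finite sets increase, so that a larger move is at least as good. *)
  exists (fun n => \bigcup_(i in `I_n.+1) F i); split => [n|m n mn y|y Ay].
  - split; last by move=> y [i _]; exact: (FP i).2.
    by apply: bigcup_finite => // i _; exact: (FP i).1.
  - by move=> [i /= im Fi]; exists i => //=; exact: leq_trans im _.
  - have [[z Ez zy]|nEy] := pselect (cover E phi y).
      by exists 0%N => //; exists z => //; left.
    have [n _ [z Fz zy]] := AF y (conj Ay nEy).
    by exists n => //; exists z => //; right; exists n => //=.
(* [h (K, E)] is a move that finishes [K] from the position [E]; outside [C] the value 0 is a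
   default. *)
have /choice[h hP] : forall p : set X * set X, exists n,
    C p.1 -> p.1 `<=` cover (p.2 `|` G p.2 n) phi.
  move=> [K E] /=; have [CK|nCK] := pselect (C K); last by exists 0%N.
  have [_ Gm AG] := GP E.
  have [||H [fH _ KH]] := @compact_finite_subcover _ K _ [set: nat]
    (fun n => cover (E `|` G E n) phi) (cC _ CK).
  - by move=> n _; exact: ophi.
  - by move=> y Ky; apply: AG; rewrite AC; exists K.
  have [k Hk] := finite_set_nat_ub fH.
  exists k => _ y /KH[i Hi [z [Ez|Gz] zy]]; first by exists z => //; left.
  by exists z => //; right; apply: Gm Gz; exact: Hk.
pose step (E : set X) n := E `|` G E n.
have [f fP] := undominated_play (fun K E => h (K, E)) step set0 ndom.
pose E := play step set0 f.
have EA n : E n `<=` A.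
  elim: n => // n IH x [/IH//|].
  by have [GA _ _] := GP (E n); move=> /(GA _).2[].
have Eincr n : E n `<=` E n.+1 by left.
have AcE : A `<=` \bigcup_n cover (E n) phi.
  move=> x; rewrite {1}AC => -[K CK Kx].
  have [k hk] := fP K CK; exists k.+1 => //.
  have [z [Ez|Gz] zx] := hP (K, E k) CK x Kx; exists z => //; first by left.
  by right; have [_ Gm _] := GP (E k); exact: Gm hk _ Gz.
exists (\bigcup_n E n); split.
- by move=> x [n _]; exact: EA.
- apply: (increasing_locally_finite phiP cA _ EA Eincr _ AcE).
    elim => //= n IH; rewrite finite_setU; split => //.
    by have [GA _ _] := GP (E n); case: (GA (f n)).
  move=> n x [//|]; have [GA _ _] := GP (E n).
  by move=> /(GA _).2[_ nE] cE; case: (nE cE).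
- by move=> x /AcE[n _ [z Ez zx]]; exists z => //; exists n.
Qed.

(** * Subspace hypotheses translated to subsets of [X] *)

Lemma covK_lt_dP {X : topologicalType} {A : set X} :
  covK_lt_d (set_type A) ->
  exists C : set (set X), [/\ forall K, C K -> compact K,
    A = \bigcup_(K in C) K &
    forall g : set X -> nat -> nat, ~ dominating (g @` C)].
Proof.
move=> [C [D [[[cC CT] _] [_ Dmin] [_ nDC]]]].
exists [set set_val @` K | K in C]; split.
- move=> _ [K CK <-]; apply: continuous_compact (cC _ CK).
  by apply: continuous_subspaceT; apply/continuousP => U oU; exists U.
- apply/seteqP; split=> [x Ax|x [_ [K _ <-] [y _ <-]]]; last exact: set_valP.
  have : [set: set_type A] (SigSub (mem_set Ax)) by [].
  rewrite -CT => -[K CK Kx]; exists (set_val @` K); first by exists K.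
  by exists (SigSub (mem_set Ax)).
(* A dominating image of [C] would have at least [d] elements, hence so would [C]. *)
- move=> g /Dmin Dg; apply: nDC; apply: card_le_trans Dg _.
  apply: card_le_trans (card_image_le _ _) _; exact: card_image_le.
Qed.

Lemma closed_set_val {X : topologicalType} {B S : set X} : closed B ->
  S `<=` B -> closed (set_val @^-1` S : set (set_type B)) -> closed S.
Proof.
move=> cB SB /closed_openC[U oU US].
suff -> : S = B `&` ~` U by apply: closedI => //; exact: open_closedC.
apply/seteqP; split=> x.
  move=> Sx; split; first exact: SB.
  move=> Ux; have : (set_val @^-1` U) (SigSub (mem_set (SB x Sx))) by [].
  by rewrite US; apply.
move=> [Bx nUx]; apply: contrapT => nSx.
have : (~` (set_val @^-1` S)) (SigSub (mem_set Bx) : set_type B) by [].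
by rewrite -US.
Qed.

(** If [x] were outside [A], finitely many closed sets missing [x] would cover the trace on [A] of a
    neighborhood of [x]; removing them leaves a neighborhood of [x] disjoint from [A]. *)
Lemma lindelof_countably_compact_nbhs {X : topologicalType} {A U : set X}
    {x : X} :
  tychonoff_space X -> (forall F, closed F -> lindelof_in (A `&` F)) ->
  open U -> U x -> countably_compact (set_type (U `&` A)) ->
  closure A x -> A x.
Proof.
move=> [hX crX] lA oU Ux ccUA clAx; apply: contrapT => nAx.
have [W Wx WU] := @completely_regular_regular Rdefinitions.R X crX x U
  (open_nbhs_nbhs (conj oU Ux)).
have /choice[G GP] : forall y, exists V, A y ->
    [/\ open V, V y & ~ closure V x].
  move=> y; have [Ay|] := pselect (A y); last by exists set0.
  have xy : y != x by apply/eqP => yx; apply: nAx; rewrite -yx.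
  have [[V V'] /= [/set_mem Vy /set_mem V'x] [oV oV' /eqP VV']] :=
    (eq_ind _ id hX _ open_hausdorff) y x xy.
  exists V => _; split=> // clVx.
  have [z [Vz V'z]] := clVx V' (open_nbhs_nbhs (conj oV' V'x)).
  by have : (V `&` V') z by []; rewrite VV'.
have [||F [FA AF]] := lA (closure W) (@closed_closure _ _) X
    (A `&` closure W) G.
- by move=> y [Ay _]; case: (GP y Ay).
- by move=> y Ay; exists y => //; case: (GP y Ay.1).
(* The complement of [closure W] is added because countable compactness is given for all of the
   trace of [U], while the sets [F n] only handle [closure W]. *)
pose V n := cover (F n) G `|` ~` closure W.
have oV n : open (V n).
  apply: openU; last exact/closed_openC/closed_closure.
  by apply: bigcup_open => y Fy; case: (GP y ((FA n).2 _ Fy).1).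
have [H fH HV] : exists2 H, finite_set H &
    [set: set_type (U `&` A)] `<=` cover H (fun n => set_val @^-1` V n).
  have [||S _ SV] := ccUA setT (fun n => set_val @^-1` V n).
  - by move=> n _; exists (V n).
  - move=> [y /= yP] _; have [Uy Ay] := set_mem yP.
    have [cWy|] := pselect (closure W y); last by exists 0%N => //=; right.
    by have [n _ Fn] := AF y (conj Ay cWy); exists n => //=; left.
  - by eexists; [|exact: SV]; exact: finite_fset.
pose Q := \bigcup_(n in H) F n.
have fG : finite_set Q by apply: bigcup_finite => // n _; exact: (FA n).1.
have cG : closed (\bigcup_(y in Q) closure (G y)).
  by apply: closed_bigcup => // y _; exact: closed_closure.
have [|y [Ay [Wy nGy]]] :=
    clAx (W `&` ~` (\bigcup_(y in Q) closure (G y))).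
  apply: filterI => //; apply: open_nbhs_nbhs; split; first exact: closed_openC.
  move=> [y [n _ Fy] Oyx]; have [_ _ nO] := GP y ((FA n).2 _ Fy).1.
  exact: nO.
have cWy := subset_closure Wy.
have UAy : (U `&` A) y by split => //; exact: WU.
have [n Hn [[z Fz zy]|//]] := HV (SigSub (mem_set UAy)) I.
apply: nGy; exists z; first by exists n.
exact: subset_closure.
Qed.

Theorem theorem3p25 (X : topologicalType) (Y : set X)
  (tychX : tychonoff_space X)
  (charmX : charming X)
  (kerY : lindelof_sigma_kernel Y)
  (exS : exists S : set X,
    [/\ S `<=` closure Y `\` Y,
        closed (set_val @^-1` S : set (set_type (closure Y))),
        covK_lt_d (set_type S) &
        forall x, ((closure Y `\` Y) `\` S) x ->
          exists U : set X,
            [/\ open U, U x & countably_compact (set_type (U `&` Y))]]) :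
  D_space X.
Proof.
have [hX _] := tychX; have T1 := hausdorff_accessible hX.
have [/lindelof_sigma_strong sY kY] := kerY.
have [S [SY clS /covK_lt_dP[C [cC SC ndom]] locS]] := exS.
have cS : closed S.
  by apply: closed_set_val clS; [exact: closed_closure|move=> x /SY[]].
(* Countably many members cover the trace of [Y] on [F]; what their union [V] leaves of [F] is the
   complement of an open set containing [Y], hence Lindelof Sigma by the choice of the kernel. *)
have lF (F : set X) : closed F -> lindelof_in F.
  move=> cF I J O oO FJ.
  have [|P [PJ YP]] := strong_sigma_lindelof (strong_sigmaI sY cF) I J O oO.
    by move=> x [_ /FJ].
  pose V := \bigcup_n cover (P n) O.
  have oV : open V.
    apply: bigcup_open => n _; apply: bigcup_open => i Pi.
    exact/oO/(PJ n).2.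
  have /lindelof_sigma_strong sV : lindelof_sigma (set_type (~` (V `|` ~` F))).
    apply: kY; first by apply: openU => //; exact: closed_openC.
    by move=> y Yy; have [Fy|] := pselect (F y); [left; exact: YP|right].
  have [|Q [QJ FQ]] := strong_sigma_lindelof sV I J O oO.
    move=> x nx; apply: FJ; apply: contrapT => nFx; apply: nx; by right.
  exists (fun n => P n `|` Q n); split=> [n|x Fx].
    have [fP PJn] := PJ n; have [fQ QJn] := QJ n.
    by rewrite finite_setU; split => // i [/PJn|/QJn].
  have [[n _ [i Pi ix]]|nVx] := pselect (V x).
    by exists n => //; exists i => //; left.
  have [[//|]//|n _ [i Qi ix]] := FQ x.
  by exists n => //; exists i => //; right.
move=> phi phiP.
have ophi := open_cover phiP.
have [D0 [_ lfD0 SD0]] := compact_cover_lt_d_D cS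
  (fun F cF => lF _ (closedI cS cF)) cC SC ndom phi phiP.
pose Y1 := Y `&` ~` cover D0 phi.
have sY1 : strong_sigma Y1 by apply: strong_sigmaI => //; exact: open_closedC.
(* Limit points of [Y1] avoid the open [cover D0 phi], hence [S]; one outside [Y] would fall under
   [locS]. *)
have cY1 : closed Y1.
  move=> x clx.
  have nD0x : ~ cover D0 phi x.
    by apply: open_closedC (ophi D0) _ _; apply: closureS clx => y [].
  have clYx : closure Y x by apply: closureS clx => y [].
  split => //; apply: contrapT => nYx.
  have [|U [oU Ux ccU]] := locS x; first by split => // /SD0.
  apply: nYx; apply: (lindelof_countably_compact_nbhs tychX _ oU Ux ccU clYx).
  by move=> F cF; exact/strong_sigma_lindelof/strong_sigmaI.
have [D1 [_ lfD1 YD1]] := strong_sigma_D cY1 sY1 phi phiP.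
pose Z := ~` (cover D0 phi `|` cover D1 phi).
have cZ : closed Z by apply/open_closedC/openU.
have sZ : strong_sigma Z.
  apply/lindelof_sigma_strong/kY; first exact: openU.
  by move=> y Yy; have [|nD0y] := pselect (cover D0 phi y);
    [left|right; apply: YD1].
have [D2 [_ lfD2 ZD2]] := strong_sigma_D cZ sZ phi phiP.
have lfD : locally_finite_set (D0 `|` D1 `|` D2).
  exact: locally_finite_setU (locally_finite_setU lfD0 lfD1) lfD2.
exists (D0 `|` D1 `|` D2); split.
- exact: locally_finite_closed.
- exact: locally_finite_discrete.
- apply/seteqP; split=> // x _.
  have [[[d Dd dx]|[d Dd dx]]|/ZD2[d Dd dx]] :=
    pselect ((cover D0 phi `|` cover D1 phi) x); exists d => //.
  + by left; left.
  + by left; right.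
  + by right.
Qed.
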